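(* Suppose $f:\mathbb{R}^{n+1}\to\mathbb{R}$ is $L$-smooth and satisfies the Polyak-Łojasiewicz inequality $$\tfrac12\|\nabla f(x)\|^2\ge\mu_{\mathrm{PL}}(f(x)-f^\star)\quad\text{for all }x,$$ with $\mu_{\mathrm{PL}}>0$ and $f^\star=\inf f$, and suppose the YAND directions are T-bounded, i.e. there is $T<\infty$ with $T_k=\|\tau_k\|\le T$ for all $k$. Then the YAND iterates produced by Armijo backtracking with $\sigma\in(0,1)$ and $\beta\in[1/2,1)$ satisfy $$f(x_{k+1})-f^\star\le\Bigl(1-\frac{2\sigma(1-\sigma)}{1+T^2}\cdot\frac{\mu_{\mathrm{PL}}}{L}\Bigr)(f(x_k)-f^\star),$$ and therefore $$f(x_k)-f^\star\le\Bigl(1-\frac{2\sigma(1-\sigma)}{1+T^2}\cdot\frac{\mu_{\mathrm{PL}}}{L}\Bigr)^k(f(x_0)-f^\star).$$ The optimal rate is obtained by taking $\sigma=\tfrac12$, and hence, for $\sigma=\tfrac12$, $$f(x_k)-f^\star\le\Bigl(1-\frac{1}{2(1+T^2)}\cdot\frac{\mu_{\mathrm{PL}}}{L}\Bigr)^k(f(x_0)-f^\star).$$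
   Context: $L$-smooth means $\|\nabla f(x)-\nabla f(y)\|\le L\|x-y\|$ for all $x,y$. The function $f$ is sufficiently smooth for the affine normals below to be defined. YAND direction. At $x_k$ with $\nabla f(x_k)\ne0$ put $e_{n+1}=\nabla f(x_k)/\|\nabla f(x_k)\|$ and let $e_1,\dots,e_n$ be an orthonormal basis of $\nabla f(x_k)^\perp$ (normal-aligned frame). With $f_{ij}=D^2f(x_k)[e_i,e_j]$, $f_{n+1,i}=D^2f(x_k)[e_{n+1},e_i]$, $f_{pqi}=D^3f(x_k)[e_p,e_q,e_i]$ ($i,j,p,q\le n$) and $(f^{ij})$ the inverse of $(f_{ij})_{i,j\le n}$, the affine normal direction is, up to a nonzero scalar, $d_{\mathrm{AN}}(x_k)\propto\sum_i\big(\sum_jf^{ij}(-\frac1{n+2}\|\nabla f(x_k)\|\sum_{p,q}f^{pq}f_{pqj}+f_{n+1,j})\big)e_i-e_{n+1}$. The direction $d_k$ is $d_{\mathrm{AN}}(x_k)$ if $\langle\nabla f(x_k),d_{\mathrm{AN}}(x_k)\rangle<0$, $-d_{\mathrm{AN}}(x_k)$ if this inner product is $>0$, and $-\nabla f(x_k)/\|\nabla f(x_k)\|$ otherwise; it is scaled so that $d_k=\sum_{i=1}^n(\tau_k)_ie_i-e_{n+1}$ with $\tau_k\in\mathbb{R}^n$, and $T_k:=\|\tau_k\|$. YAND iterates: $x_{k+1}=x_k+\alpha_kd_k$, stopping when $\nabla f(x_k)=0$; $k$ ranges over the generated iterates. Armijo backtracking: given $\sigma,\beta\in(0,1)$ and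 an initial trial step $\alpha_0>0$ (e.g. $\alpha_0=1$), $\alpha_k=\beta^m\alpha_0$ for the smallest integer $m\ge0$ with $f(x_k+\beta^m\alpha_0d_k)\le f(x_k)+\sigma\beta^m\alpha_0\langle\nabla f(x_k),d_k\rangle$.
   Formalization: The formal theorem adds that the initial trial step satisfies α_0 ≥ (1−σ)‖∇f(x_k)‖/(L(1+T²)) at every step k; without it the claim fails, e.g. f=‖x‖²/2, α_0=1, σ=1/2, ‖x_0‖=100. *)

(* Defs.v *)
From HB Require Import structures.
From mathcomp Require Import all_boot all_order all_algebra.
From mathcomp Require Import all_classical all_reals all_analysis.

Set Implicit Arguments.
Unset Strict Implicit.
Unset Printing Implicit Defensive.

Import Order.TTheory GRing.Theory Num.Theory.
Import numFieldNormedType.Exports.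
Local Open Scope classical_set_scope.
Local Open Scope ring_scope.

(* The library norm `|u| on 'rV[R]_n is the sup norm, hence the explicit
   Euclidean structure. *)
Definition dotv (R : realType) (n : nat) (u v : 'rV[R]_n) : R :=
  \sum_(i < n) u 0 i * v 0 i.

Definition enorm (R : realType) (n : nat) (u : 'rV[R]_n) : R :=
  Num.sqrt (dotv u u).

Fixpoint class_C (R : realType) (n k : nat) (f : 'rV[R]_n.+1 -> R) : Prop :=
  if k is k'.+1 then
    (forall x, differentiable f x) /\ (forall v, class_C k' (fun x => 'D_v f x))
  else continuous f.

Definition grad (R : realType) (n : nat) (f : 'rV[R]_n.+1 -> R)
    (x : 'rV[R]_n.+1) : 'rV[R]_n.+1 :=
  \row_i 'D_(delta_mx 0 i) f x.

Definition D2 (R : realType) (n : nat) (f : 'rV[R]_n.+1 -> R)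
    (x u v : 'rV[R]_n.+1) : R :=
  'D_u (fun y => 'D_v f y) x.

Definition D3 (R : realType) (n : nat) (f : 'rV[R]_n.+1 -> R)
    (x u v w : 'rV[R]_n.+1) : R :=
  'D_u (fun y => D2 f y v w) x.

Definition lipschitz_grad (R : realType) (n : nat) (f : 'rV[R]_n.+1 -> R)
    (L : R) : Prop :=
  forall x y, enorm (grad f x - grad f y) <= L * enorm (x - y).

Definition PL_inequality (R : realType) (n : nat) (f : 'rV[R]_n.+1 -> R)
    (mu fstar : R) : Prop :=
  forall x, 2^-1 * enorm (grad f x) ^+ 2 >= mu * (f x - fstar).

Definition unit_grad (R : realType) (n : nat) (f : 'rV[R]_n.+1 -> R)
    (x : 'rV[R]_n.+1) : 'rV[R]_n.+1 :=
  (enorm (grad f x))^-1 *: grad f x.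

(* n orthonormal vectors orthogonal to the nonzero vector grad f x of R^(n+1),
   i.e. an orthonormal basis of its orthogonal complement. *)
Definition normal_aligned (R : realType) (n : nat) (f : 'rV[R]_n.+1 -> R)
    (x : 'rV[R]_n.+1) (e : 'I_n -> 'rV[R]_n.+1) : Prop :=
  (forall i j, dotv (e i) (e j) = (i == j)%:R) /\
  (forall i, dotv (e i) (grad f x) = 0).

Definition tangent_hess (R : realType) (n : nat) (f : 'rV[R]_n.+1 -> R)
    (x : 'rV[R]_n.+1) (e : 'I_n -> 'rV[R]_n.+1) : 'M[R]_n :=
  \matrix_(i, j) D2 f x (e i) (e j).

Definition affine_normal_coef (R : realType) (n : nat) (f : 'rV[R]_n.+1 -> R)
    (x : 'rV[R]_n.+1) (e : 'I_n -> 'rV[R]_n.+1) (i : 'I_n) : R :=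
  let F := invmx (tangent_hess f x e) in
  \sum_(j < n) F i j *
    (- (n.+2%:R)^-1 * enorm (grad f x) *
       (\sum_(p < n) \sum_(q < n) F p q * D3 f x (e p) (e q) (e j))
     + D2 f x (unit_grad f x) (e j)).

(* Only defined (inhabited) where the tangential Hessian is invertible, and
   only up to a nonzero scalar. *)
Definition is_affine_normal (R : realType) (n : nat) (f : 'rV[R]_n.+1 -> R)
    (x : 'rV[R]_n.+1) (e : 'I_n -> 'rV[R]_n.+1) (v : 'rV[R]_n.+1) : Prop :=
  tangent_hess f x e \in unitmx /\
  exists2 c : R, c != 0 &
    v = c *: (\sum_(i < n) affine_normal_coef f x e i *: e i - unit_grad f x).

Definition descent_choice (R : realType) (n : nat) (f : 'rV[R]_n.+1 -> R)
    (x v : 'rV[R]_n.+1) : 'rV[R]_n.+1 :=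
  if dotv (grad f x) v < 0 then v
  else if dotv (grad f x) v > 0 then - v
  else - unit_grad f x.

Definition is_yand_direction (R : realType) (n : nat) (f : 'rV[R]_n.+1 -> R)
    (x : 'rV[R]_n.+1) (tau : 'rV[R]_n) (d : 'rV[R]_n.+1) : Prop :=
  exists (e : 'I_n -> 'rV[R]_n.+1) (v : 'rV[R]_n.+1) (s : R),
    [/\ normal_aligned f x e,
        is_affine_normal f x e v,
        0 < s,
        d = s *: descent_choice f x v &
        d = \sum_(i < n) tau 0 i *: e i - unit_grad f x].

Definition armijo_cond (R : realType) (n : nat) (f : 'rV[R]_n.+1 -> R)
    (sigma : R) (x d : 'rV[R]_n.+1) (a : R) : bool :=
  f (x + a *: d) <= f x + sigma * a * dotv (grad f x) d.

Definition is_armijo_step (R : realType) (n : nat) (f : 'rV[R]_n.+1 -> R)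
    (sigma beta alpha0 : R) (x d : 'rV[R]_n.+1) (a : R) : Prop :=
  exists m : nat,
    [/\ a = beta ^+ m * alpha0,
        armijo_cond f sigma x d (beta ^+ m * alpha0) &
        forall m' : nat, (m' < m)%N ->
          ~~ armijo_cond f sigma x d (beta ^+ m' * alpha0)].

(* The method stops at the first zero of the gradient: x k is an actual iterate
   iff no earlier iterate is stationary. The values of x past the stopping
   index are irrelevant. *)
Definition generated (R : realType) (n : nat) (f : 'rV[R]_n.+1 -> R)
    (x : nat -> 'rV[R]_n.+1) (k : nat) : Prop :=
  forall j : nat, (j < k)%N -> grad f (x j) != 0.

Definition yand_armijo_run (R : realType) (n : nat) (f : 'rV[R]_n.+1 -> R)
    (sigma beta alpha0 : R) (x : nat -> 'rV[R]_n.+1) (tau : nat -> 'rV[R]_n)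
    (d : nat -> 'rV[R]_n.+1) (alpha : nat -> R) : Prop :=
  forall k : nat, generated f x k.+1 ->
    [/\ is_yand_direction f (x k) (tau k) (d k),
        is_armijo_step f sigma beta alpha0 (x k) (d k) (alpha k) &
        x k.+1 = x k + alpha k *: d k].

Definition T_bounded (R : realType) (n : nat) (f : 'rV[R]_n.+1 -> R)
    (x : nat -> 'rV[R]_n.+1) (tau : nat -> 'rV[R]_n) (T : R) : Prop :=
  forall k : nat, generated f x k.+1 -> enorm (tau k) <= T.

(* The initial trial step never lies below the step length
   (1 - sigma) |grad f(x_k)| / (L (1 + T^2)) that backtracking with
   beta >= 1/2 guarantees once a trial step is rejected. It cannot be dropped:
   for f(x) = |x|^2 / 2 (L = mu = 1, T = 0), alpha0 = 1, sigma = 1/2 and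
   |x_0| = 100, the unit step is accepted and f only drops from 100^2/2
   to 99^2/2, while the claimed factor is 1/2. *)
Definition initial_step_large (R : realType) (n : nat) (f : 'rV[R]_n.+1 -> R)
    (L sigma T alpha0 : R) (x : nat -> 'rV[R]_n.+1) : Prop :=
  forall k : nat, generated f x k.+1 ->
    (1 - sigma) * enorm (grad f (x k)) / (L * (1 + T ^+ 2)) <= alpha0.

(* Main.v *)
Require Import Defs.
From HB Require Import structures.
From mathcomp Require Import all_boot all_order all_algebra.
From mathcomp Require Import all_classical all_reals all_analysis.
From mathcomp Require Import ring lra.

Import Order.TTheory GRing.Theory Num.Theory.
Import numFieldNormedType.Exports.
Local Open Scope classical_set_scope.
Local Open Scope ring_scope.

(* The quadratic upper model of an L-smooth function accepts every trial step of
   length at most 2 (1 - sigma) |grad f| / (L |d|^2), so backtracking with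
   beta >= 1/2 stops at a step of length at least
   (1 - sigma) |grad f| / (L (1 + T^2)), since |d|^2 = 1 + |tau|^2. As
   <grad f, d> = - |grad f|, the Armijo condition then gives a decrease
   proportional to |grad f|^2, which PL bounds below by the gap f - f^*. *)

(** * Euclidean inner product and norm on row vectors *)

Section Euclidean.
Context {R : realType} {m : nat}.
Implicit Types (u v w : 'rV[R]_m) (c : R).

Lemma dotvC u v : dotv u v = dotv v u.
Proof. by apply: eq_bigr => i _; rewrite mulrC. Qed.

Lemma dotvDl u v w : dotv (u + v) w = dotv u w + dotv v w.
Proof. by rewrite -big_split; apply: eq_bigr => i _; rewrite mxE mulrDl. Qed.

Lemma dotvZl c u v : dotv (c *: u) v = c * dotv u v.
Proof. by rewrite mulr_sumr; apply: eq_bigr => i _; rewrite mxE mulrA. Qed.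

Lemma dotvZr c u v : dotv v (c *: u) = c * dotv v u.
Proof. by rewrite dotvC dotvZl [dotv u v]dotvC. Qed.

Lemma dotvBl u v w : dotv (u - v) w = dotv u w - dotv v w.
Proof. by rewrite -scaleN1r dotvDl dotvZl mulN1r. Qed.

Lemma dotvBr u v w : dotv w (u - v) = dotv w u - dotv w v.
Proof. by rewrite dotvC dotvBl ![dotv _ w]dotvC. Qed.

Lemma dotv_suml k (F : 'I_k -> 'rV[R]_m) v :
  dotv (\sum_(i < k) F i) v = \sum_(i < k) dotv (F i) v.
Proof.
rewrite [RHS]exchange_big; apply: eq_bigr => i _.
by rewrite summxE mulr_suml.
Qed.

Lemma dotv_ge0 u : 0 <= dotv u u.
Proof. by apply: sumr_ge0 => i _; rewrite -expr2 sqr_ge0. Qed.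

Lemma dotv_eq0 u : (dotv u u == 0) = (u == 0).
Proof.
apply/idP/eqP => [|->]; last by rewrite /dotv big1// => i _; rewrite mxE mul0r.
rewrite psumr_eq0 => [/allP u0|i _]; last by rewrite -expr2 sqr_ge0.
apply/rowP => i; rewrite mxE; apply/eqP.
by have := u0 i (mem_index_enum _); rewrite -expr2 sqrf_eq0.
Qed.

Lemma enorm_ge0 u : 0 <= enorm u.
Proof. exact: sqrtr_ge0. Qed.

Lemma sqr_enorm u : enorm u ^+ 2 = dotv u u.
Proof. by rewrite sqr_sqrtr// dotv_ge0. Qed.

Lemma enorm_eq0 u : (enorm u == 0) = (u == 0).
Proof. by rewrite -sqrf_eq0 sqr_enorm dotv_eq0. Qed.

Lemma enormZ c u : enorm (c *: u) = `|c| * enorm u.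
Proof.
by rewrite /enorm dotvZl dotvZr mulrA -expr2 sqrtrM ?sqr_ge0// sqrtr_sqr.
Qed.

(** Cauchy-Schwarz: the square of $|v| u - |u| v$ is nonnegative and expands to $2 |u| |v| (|u| |v|
    - \langle u, v\rangle)$. Cancelling the positive factor requires $u$ and $v$ nonzero, so zero
    vectors are treated first. *)
Lemma dotv_le_enorm u v : dotv u v <= enorm u * enorm v.
Proof.
have [->|u0] := eqVneq u 0.
  by rewrite -(scale0r (0 : 'rV[R]_m)) dotvZl enormZ normr0 !mul0r.
have [->|v0] := eqVneq v 0.
  by rewrite -(scale0r (0 : 'rV[R]_m)) dotvZr enormZ normr0 !mul0r mulr0.
have nu : 0 < enorm u by rewrite lt_def enorm_eq0 u0 enorm_ge0.
have nv : 0 < enorm v by rewrite lt_def enorm_eq0 v0 enorm_ge0.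
have := dotv_ge0 (enorm v *: u - enorm u *: v).
rewrite !(dotvBl, dotvBr, dotvZl, dotvZr) -!sqr_enorm [dotv v u]dotvC.
rewrite (_ : _ - _ = 2 * (enorm u * enorm v) * (enorm u * enorm v - dotv u v));
  last by ring.
by rewrite pmulr_rge0 ?subr_ge0// !mulr_gt0.
Qed.

End Euclidean.

(** * Differentiation along lines and the quadratic upper model *)

Section Smooth.
Context {R : realType} {n : nat} (f : 'rV[R]_n.+1 -> R).
Implicit Types (x d : 'rV[R]_n.+1).

Lemma derive_dotv_grad x d : differentiable f x -> 'D_d f x = dotv (grad f x) d.
Proof.
move=> fx; rewrite deriveE// {1}(row_sum_delta d) linear_sum.
by apply: eq_bigr => i _; rewrite linearZ mxE deriveE// mulrC.
Qed.

(** The difference quotient of the restriction of [f] to the line is exactly the directional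
    quotient of [f] at [x + t *: d]. *)
Lemma is_derive_line x d (t : R) : differentiable f (x + t *: d) ->
  is_derive t (1 : R) (fun s : R => f (x + s *: d))
    (dotv (grad f (x + t *: d)) d).
Proof.
move=> fx; rewrite -derive_dotv_grad//.
have quotE : (fun h : R => h^-1 *: (f (x + (h *: 1 + t) *: d) - f (x + t *: d)))
    = (fun h : R => h^-1 *: (f (h *: d + (x + t *: d)) - f (x + t *: d))).
  apply/funext => h; congr (_ *: (f _ - _)).
  by rewrite scalerDl addrCA /GRing.scale/= mulr1.
split; last by rewrite /derive /= quotE.
by rewrite /derivable /= quotE; exact: diff_derivable.
Qed.

(** [gap] is [f] along the segment minus the nonconstant part of the model. By Cauchy-Schwarz and
    the Lipschitz bound its derivative [dgap] is nonpositive at positive times, so the mean value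
    theorem gives [gap a <= gap 0]. *)
Lemma lipschitz_grad_upper_model (L : R) x d (a : R) :
  (forall y, differentiable f y) -> lipschitz_grad f L -> 0 < a ->
  f (x + a *: d) <=
    f x + a * dotv (grad f x) d + L * a ^+ 2 / 2 * dotv d d.
Proof.
move=> df lip a0.
pose gap (t : R) := f (x + t *: d)
   - (t * dotv (grad f x) d + t ^+ 2 * (L / 2 * dotv d d)).
pose dgap (t : R) := dotv (grad f (x + t *: d)) d
   - (dotv (grad f x) d + 2 * t * (L / 2 * dotv d d)).
have gapD (t : R) : is_derive t (1 : R) gap (dgap t).
  apply: is_deriveB; first exact/is_derive_line/df.
  apply: is_derive_eq.
  by rewrite /GRing.scale /=; ring.
have [t /[!in_itv]/= /andP[t0 _]] := MVT a0 (fun t _ => gapD t)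
  (derivable_within_continuous (fun t _ => @ex_derive _ _ _ _ _ _ _ (gapD t))).
suff : dgap t <= 0.
  move=> dgap0 gapE; have : gap a - gap 0 <= 0.
    by rewrite gapE pmulr_lle0 ?subr_gt0.
  by rewrite /gap scale0r addr0; lra.
have := lip (x + t *: d) x; rewrite addrAC subrr add0r enormZ gtr0_norm// => lipt.
have : dotv (grad f (x + t *: d) - grad f x) d <= L * (t * enorm d) * enorm d.
  by rewrite (le_trans (dotv_le_enorm _ _))// ler_wpM2r// enorm_ge0.
by rewrite dotvBl /dgap -sqr_enorm; nra.
Qed.

End Smooth.

(** * Geometry of the direction and the accepted step *)

Section YandStep.
Context {R : realType} {n : nat} (f : 'rV[R]_n.+1 -> R).
Implicit Types (x d : 'rV[R]_n.+1) (tau : 'rV[R]_n).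

Lemma dotv_grad_unit_grad x : dotv (grad f x) (unit_grad f x) = enorm (grad f x).
Proof.
rewrite dotvZr -sqr_enorm; have [->|g0] := eqVneq (enorm (grad f x)) 0.
  by rewrite expr0n mulr0.
by rewrite expr2 mulKf.
Qed.

Lemma yand_direction_slope x tau d : is_yand_direction f x tau d ->
  dotv (grad f x) d = - enorm (grad f x).
Proof.
move=> [e [v [s [[_ eg] _ _ _ ->]]]].
rewrite dotvBr dotv_grad_unit_grad dotvC dotv_suml big1 ?add0r// => i _.
by rewrite dotvZl eg mulr0.
Qed.

(** Pythagoras: the tangential part [w] has the length of [tau] because the frame is orthonormal,
    and it is orthogonal to the unit normal. *)
Lemma yand_direction_sqr_norm x tau d : grad f x != 0 ->
  is_yand_direction f x tau d -> dotv d d = 1 + dotv tau tau.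
Proof.
move=> g0 [e [v [s [[ee eg] _ _ _ ->]]]].
set w := \sum_(i < n) _.
have wg : dotv w (unit_grad f x) = 0.
  by rewrite dotv_suml big1// => i _; rewrite dotvZl dotvZr eg !mulr0.
have ww : dotv w w = dotv tau tau.
  rewrite {1}/w dotv_suml; apply: eq_bigr => i _; rewrite dotvZl; congr (_ * _).
  rewrite dotvC dotv_suml (bigD1 i)//= big1 ?addr0 => [|j /negPf ji].
    by rewrite dotvZl ee eqxx mulr1.
  by rewrite dotvZl ee ji mulr0.
have uu : dotv (unit_grad f x) (unit_grad f x) = 1.
  by rewrite {1}/unit_grad dotvZl dotv_grad_unit_grad mulVf// enorm_eq0.
rewrite dotvBl !dotvBr ww wg [dotv _ w]dotvC wg uu; ring.
Qed.

(** For such [a] the quadratic term of the upper model is at most the share $1-\sigma$ of the linear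
    decrease, which leaves the share $\sigma$. *)
Lemma armijo_cond_small_step (L sigma : R) x d (a : R) :
  (forall y, differentiable f y) -> lipschitz_grad f L -> 0 < a ->
  L * a * dotv d d <= - 2 * (1 - sigma) * dotv (grad f x) d ->
  armijo_cond f sigma x d a.
Proof.
move=> df lip a0 small.
apply: le_trans (lipschitz_grad_upper_model f L x d a df lip a0) _.
by nra.
Qed.

(** The condition on [b] has half the constant of the small-step criterion, so every positive trial
    up to [2 * b] is accepted. With no backtracking the step is [alpha0], which is at least [b]. *)
Lemma armijo_step_lower_bound (L sigma beta alpha0 : R) x d (a b : R) :
  (forall y, differentiable f y) -> lipschitz_grad f L ->
  0 < L -> 2^-1 <= beta -> 0 < alpha0 -> b <= alpha0 ->
  L * b * dotv d d <= - (1 - sigma) * dotv (grad f x) d ->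
  is_armijo_step f sigma beta alpha0 x d a -> b <= a.
Proof.
move=> df lip L0 beta2 alpha00 b_le bE [[|m] [-> _ rejected]].
  by rewrite expr0 mul1r.
have beta0 : 0 < beta by lra.
set t := beta ^+ m * alpha0.
have t0 : 0 < t by rewrite mulr_gt0// exprn_gt0.
(* Here [t] is the last rejected trial. If [beta * t < b], then [t < 2 * b] since [beta >= 1/2], and
   [t] would have been accepted. *)
rewrite exprS -mulrA -/t leNgt; apply/negP => tb.
have /negP[] := rejected m (ltnSn m); rewrite -/t.
apply: (armijo_cond_small_step L) => //.
have : L * t * dotv d d <= L * (2 * b) * dotv d d.
  rewrite ler_wpM2r ?dotv_ge0// ler_wpM2l ?ltW//; nra.
by lra.
Qed.

Lemma yand_armijo_decrease (L sigma beta alpha0 T : R) x tau d (a : R) :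
  (forall y, differentiable f y) -> lipschitz_grad f L -> grad f x != 0 ->
  0 < L -> 0 < sigma -> sigma < 1 -> 2^-1 <= beta -> 0 < alpha0 ->
  is_yand_direction f x tau d -> is_armijo_step f sigma beta alpha0 x d a ->
  enorm tau <= T ->
  (1 - sigma) * enorm (grad f x) / (L * (1 + T ^+ 2)) <= alpha0 ->
  f (x + a *: d) <=
    f x - sigma * (1 - sigma) / (L * (1 + T ^+ 2)) * enorm (grad f x) ^+ 2.
Proof.
move=> df lip g0 L0 sigma0 sigma1 beta2 alpha00 dir step tauT alpha0_ge.
have slope := yand_direction_slope _ _ _ dir.
have normd := yand_direction_sqr_norm _ _ _ g0 dir.
have G0 : 0 <= enorm (grad f x) by exact: enorm_ge0.
have LT0 : 0 < L * (1 + T ^+ 2) by rewrite mulr_gt0// ltr_wpDr ?sqr_ge0.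
(* Squaring is monotone here because [T] dominates a norm and is thus nonnegative. *)
have tauT2 : dotv tau tau <= T ^+ 2.
  by rewrite -sqr_enorm lerXn2r ?nnegrE ?(le_trans _ tauT) ?enorm_ge0.
set b := (X in X <= _) in alpha0_ge.
have b0 : 0 <= b by apply: divr_ge0; [rewrite mulr_ge0 ?subr_ge0// ltW | exact: ltW].
have bE : b * (L * (1 + T ^+ 2)) = (1 - sigma) * enorm (grad f x).
  by rewrite divfK// gt_eqF.
have b_le : b <= a.
  apply: (armijo_step_lower_bound L sigma beta alpha0 x d) => //.
  rewrite slope normd mulrNN -bE [L * b]mulrC -mulrA ler_wpM2l//.
  by rewrite ler_wpM2l ?lerD2l// ltW.
have [m [aE + _]] := step; rewrite -aE /armijo_cond slope => /le_trans; apply.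
rewrite (_ : _ * _ ^+ 2 = sigma * b * enorm (grad f x)); last by rewrite /b; ring.
by rewrite lerD2l mulrN lerN2 ler_wpM2r// ler_wpM2l// ltW.
Qed.

End YandStep.

Theorem corollary7p8 (R : realType) (n : nat) (f : 'rV[R]_n.+1 -> R)
    (L mu sigma beta alpha0 T : R)
    (x : nat -> 'rV[R]_n.+1) (tau : nat -> 'rV[R]_n)
    (d : nat -> 'rV[R]_n.+1) (alpha : nat -> R)
    (f_C3 : class_C 3 f)
    (L_gt0 : 0 < L)
    (f_smooth : lipschitz_grad f L)
    (mu_gt0 : 0 < mu)
    (f_bounded_below : has_lbound (range f))
    (f_PL : PL_inequality f mu (inf (range f)))
    (sigma_gt0 : 0 < sigma) (sigma_lt1 : sigma < 1)
    (beta_ge : 2^-1 <= beta) (beta_lt1 : beta < 1)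
    (alpha0_gt0 : 0 < alpha0)
    (run : yand_armijo_run f sigma beta alpha0 x tau d alpha)
    (T_bound : T_bounded f x tau T)
    (alpha0_large : initial_step_large f L sigma T alpha0 x) :
  [/\ forall k : nat, generated f x k.+1 ->
        f (x k.+1) - inf (range f)
          <= (1 - 2 * sigma * (1 - sigma) / (1 + T ^+ 2) * (mu / L))
             * (f (x k) - inf (range f)),
      forall k : nat, generated f x k ->
        f (x k) - inf (range f)
          <= (1 - 2 * sigma * (1 - sigma) / (1 + T ^+ 2) * (mu / L)) ^+ k
             * (f (x 0%N) - inf (range f)),
      forall s : R, 0 < s -> s < 1 ->
        1 - 2 * 2^-1 * (1 - 2^-1) / (1 + T ^+ 2) * (mu / L)
          <= 1 - 2 * s * (1 - s) / (1 + T ^+ 2) * (mu / L) &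
      sigma = 2^-1 ->
      forall k : nat, generated f x k ->
        f (x k) - inf (range f)
          <= (1 - 1 / (2 * (1 + T ^+ 2)) * (mu / L)) ^+ k
             * (f (x 0%N) - inf (range f))].
Proof.
have df : forall y, differentiable f y by case: f_C3.
have T1 : 0 < 1 + T ^+ 2 by rewrite ltr_wpDr ?sqr_ge0.
set fs := inf (range f); set q := (X in (1 - X)).
(* Boundedness below makes [inf] a genuine lower bound of the range. *)
have fs_le y : 0 <= f y - fs by rewrite subr_ge0 ge_inf//; exists y.
pose c := sigma * (1 - sigma) / (L * (1 + T ^+ 2)).
have c0 : 0 < c by rewrite divr_gt0 ?mulr_gt0 ?subr_gt0.
have qE : q = 2 * mu * c by rewrite /q /c; field; rewrite !gt_eqF.
have decrease k : generated f x k.+1 ->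
    f (x k.+1) <= f (x k) - c * enorm (grad f (x k)) ^+ 2.
  move=> gk; have [dir step ->] := run k gk.
  exact: (yand_armijo_decrease f L sigma beta alpha0 T _ _ _ _ df f_smooth
    (gk k (ltnSn k)) L_gt0 sigma_gt0 sigma_lt1 beta_ge alpha0_gt0 dir step
    (T_bound k gk) (alpha0_large k gk)).
have contract k : generated f x k.+1 ->
    f (x k.+1) - fs <= (1 - q) * (f (x k) - fs).
  move=> gk; have := decrease k gk; have := f_PL (x k).
  (* Multiplying the PL inequality by [c] matches its gradient term with the decrease; what remains
     is linear in the products. *)
  rewrite -/fs -(ler_pM2l c0) qE mulrBl mul1r.
  by move: (_ ^+ 2) (c) => G2 c' PL dec; lra.
(* A nonstationary iterate lies strictly above f^*, so the contraction factor
   cannot be negative and the one-step bounds may be multiplied. *)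
have q1 k : generated f x k.+1 -> 0 <= 1 - q.
  move=> gk; have gap0 : 0 < f (x k) - fs.
    apply: le_lt_trans (fs_le (x k.+1)) _.
    rewrite ltrD2r (le_lt_trans (decrease k gk))// gtrDl oppr_lt0.
    by rewrite mulr_gt0// exprn_gt0// lt_def enorm_ge0 enorm_eq0 (gk k).
  by rewrite -(pmulr_lge0 _ gap0) (le_trans (fs_le _) (contract k gk)).
have rate k : generated f x k -> f (x k) - fs <= (1 - q) ^+ k * (f (x 0%N) - fs).
  (* At [k = 0] the factor is 1 whatever the sign of [1 - q]; in the inductive step [x k] is
     nonstationary, so [q1] applies. *)
  elim: k => [|k IHk] gk; first by rewrite expr0 mul1r.
  rewrite (le_trans (contract k gk))// exprS -mulrA ler_wpM2l ?(q1 k)//.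
  by apply: IHk => j jk; rewrite gk// ltnW.
split=> // [s s0 s1|sigmaE k gk].
  rewrite lerD2l lerN2 !ler_wpM2r ?divr_ge0 ?invr_ge0 ?(ltW T1) ?(ltW mu_gt0) ?(ltW L_gt0)//.
  (* Optimality of one half: $s(1-s) = \frac14 - (s-\frac12)^2$. *)
  by have := sqr_ge0 (s - 2^-1); lra.
rewrite (_ : 1 / _ * _ = q) ?rate// /q sigmaE.
by field; rewrite !gt_eqF.
Qed.
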